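(* Let $d$ be a positive integer and let $\Psi$ be a probability measure on the probability simplex $\Delta^{d-1}$ which is absolutely continuous with respect to the uniform measure on $\Delta^{d-1}$. Let $\Gamma_1,\dots,\Gamma_d$ be independent random vectors, each distributed according to $\Psi$. Then $\Gamma_1,\dots,\Gamma_d$ are linearly independent (as vectors in $\mathbb{R}^d$) with probability one.
   Context: $\Delta^{d-1}=\{x\in\mathbb{R}^d : x_i\ge 0 \text{ for all } i,\ \sum_{i=1}^d x_i=1\}$ with its Borel $\sigma$-algebra. The uniform measure on $\Delta^{d-1}$ is the normalized $(d-1)$-dimensional Lebesgue measure on the affine hyperplane $\{x\in\mathbb{R}^d:\sum_i x_i=1\}$ restricted to $\Delta^{d-1}$. *)

(* Defs.v *)
From HB Require Import structures.
From mathcomp Require Import all_boot all_order all_algebra.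
From mathcomp Require Import lra.
From mathcomp Require Import all_classical all_reals all_analysis.
From mathcomp Require Import measurable_realfun.

Set Implicit Arguments.
Unset Strict Implicit.
Unset Printing Implicit Defensive.

Import Order.TTheory GRing.Theory Num.Theory.
Import numFieldNormedType.Exports.

Local Open Scope classical_set_scope.
Local Open Scope ring_scope.

(* 'rV[R]_d with its Borel sigma-algebra, i.e. the one generated by the open
   sets of the topology of the matrix (sup) norm. *)
Definition borel_rV (R : realType) (d : nat) :=
  g_sigma_algebraType (@open 'rV[R]_d).

HB.instance Definition _ (R : realType) (d : nat) :=
  Measurable.on (borel_rV R d).

Section borel_rV_theory.
Context {R : realType}.

Lemma measurable_coord d (j : 'I_d) :
  measurable_fun [set: borel_rV R d]
    (fun v : borel_rV R d => (v : 'rV[R]_d) 0 j : measurableTypeR R).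
Proof.
move=> mT; apply: (measurability _ (RGenOpens.measurableE R)) => //.
move=> _ [_ [a [b ->]] <-].
rewrite setTI; apply: sub_sigma_algebra.
by apply: open_comp; [move=> v _; exact: coord_continuous | exact: interval_open].
Qed.

Lemma measurable_fun_rVP d0 (T : measurableType d0) d (f : T -> borel_rV R d) :
  measurable_fun [set: T] f <->
  forall j, measurable_fun [set: T]
    (fun x => (f x : 'rV[R]_d) 0 j : measurableTypeR R).
Proof.
split=> [mf j|mf].
  exact: (measurableT_comp (measurable_coord j) mf).
move=> mT; apply: (measurability _ (erefl (@measurable _ (borel_rV R d)))) => //.
move=> _ [U oU <-].
rewrite setTI.
pose box (p : 'rV[rat]_d * nat) : set 'rV[R]_d :=
  [set v | forall j, v 0 j \in `](ratr (p.1 0 j) - p.2.+1%:R^-1),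
                                 (ratr (p.1 0 j) + p.2.+1%:R^-1)[].
have -> : f @^-1` U = \bigcup_(p in [set p | box p `<=` U]) (f @^-1` box p).
  apply/seteqP; split=> [x /= Ux|x [p /= pU]]; last exact: pU.
  have := oU; rewrite openE => /(_ _ Ux); rewrite /interior => /nbhs_ballP[e /= e0 eU].
  have [k ke] : exists k : nat, k.+1%:R^-1 < e / 2.
    have /ltr_add_invr[k] : 0 < e / 2 by rewrite divr_gt0.
    by rewrite add0r => ?; exists k.
  have /choice[q qP] : forall j, exists q : rat,
      ratr q \in `]((f x : 'rV[R]_d) 0 j - k.+1%:R^-1),
                   ((f x : 'rV[R]_d) 0 j + k.+1%:R^-1)[.
    by move=> j; apply: rat_in_itvoo; rewrite ltrD2l gtrN// invr_gt0.
  exists (\row_j q j, k) => /=; last first.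
    move=> j; rewrite !mxE; have := qP j; rewrite !in_itv/= => /andP[h1 h2].
    by rewrite ltrBlDr h2/= -ltrBlDr h1.
  move=> v vb; apply: eU; split => // i j; rewrite (ord1 i) {i}.
  have := vb j; have := qP j; rewrite !mxE !in_itv/= => /andP[h1 h2] /andP[h3 h4].
  have aux (a b c s : R) : s < e / 2 -> a - s < b -> b < a + s ->
      b - s < c -> c < b + s -> (- e < a - c) && (a - c < e).
    by move=> ? ? ? ? ?; apply/andP; split; lra.
  by rewrite /ball/= ltr_norml; exact: aux ke h1 h2 h3 h4.
rewrite (_ : \bigcup_(p in _) _ = \bigcup_k
    (if unpickle k is Some p then
      if `[< box p `<=` U >] then f @^-1` box p else set0 else set0)); last first.
  apply/seteqP; split=> [x [p /= pU xp]|x [k _]].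
    by exists (pickle p) => //=; rewrite pickleK asboolT.
  by case: unpickle => // p; case: asboolP => // pU xp; exists p.
apply: bigcupT_measurable => k; case: unpickle => // p; case: ifP => // _.
rewrite (_ : f @^-1` box p = \bigcap_(j in [set: 'I_d]) ((fun x =>
   (f x : 'rV[R]_d) 0 j : measurableTypeR R) @^-1`
   [set` `](ratr (p.1 0 j) - p.2.+1%:R^-1), (ratr (p.1 0 j) + p.2.+1%:R^-1)[])); last first.
  by apply/seteqP; split => [x /= h j _|x h j]; [exact: h|exact: h].
apply: fin_bigcap_measurable => // j _.
by rewrite -[X in measurable X]setTI; apply: mf.
Qed.

End borel_rV_theory.

(* pushforward by a bundled measurable function: unlike pushforward itself,
   it is inferred to be a measure without a side condition. *)
Section image_measure.
Context d d' (T : measurableType d) (T' : measurableType d') (R : realType).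
Variables (mu : {measure set T -> \bar R}) (f : {mfun T >-> T'}).

Definition image_measure : set T' -> \bar R := pushforward mu f.

Let image_measure0 : image_measure set0 = 0%E.
Proof. exact: measure0. Qed.

Let image_measure_ge0 A : (0 <= image_measure A)%E.
Proof. exact: measure_ge0. Qed.

Let image_measure_sigma_additive : semi_sigma_additive image_measure.
Proof. exact: measure_semi_sigma_additive. Qed.

HB.instance Definition _ := isMeasure.Build _ _ _ image_measure
  image_measure0 image_measure_ge0 image_measure_sigma_additive.

End image_measure.

(* Lebesgue measure on R^n, by induction on n: the unit mass on the point R^0,
   then the image under the bijection cons_rV of the product of the Lebesgue
   measures on R and R^n. *)
Section lebesgue_measure_rV.
Context {R : realType}.

Definition cons_rV n (p : measurableTypeR R * borel_rV R n) :
    borel_rV R n.+1 :=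
  row_mx (const_mx p.1 : 'rV[R]_1) (p.2 : 'rV[R]_n).

Lemma cons_rV0 n p : (cons_rV p : 'rV[R]_n.+1) 0 0 = p.1.
Proof.
have := row_mxEl (const_mx p.1 : 'rV[R]_1) (p.2 : 'rV[R]_n) 0 0.
rewrite [RHS]mxE => <-; rewrite /cons_rV; congr (fun_of_matrix _ _ _).
exact: val_inj.
Qed.

Lemma cons_rVS n p (j : 'I_n) :
  (cons_rV p : 'rV[R]_n.+1) 0 (lift 0 j) = (p.2 : 'rV[R]_n) 0 j.
Proof.
have <- := row_mxEr (const_mx p.1 : 'rV[R]_1) (p.2 : 'rV[R]_n) 0 j.
rewrite /cons_rV; congr (fun_of_matrix _ _ _); exact: val_inj.
Qed.

Lemma measurable_cons_rV n : measurable_fun setT (@cons_rV n).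
Proof.
apply/measurable_fun_rVP => j; have [j' ->|->] := unliftP 0 j.
  under eq_fun do rewrite cons_rVS.
  exact: (measurableT_comp (measurable_coord j')).
under eq_fun do rewrite cons_rV0.
exact: measurable_fst.
Qed.

HB.instance Definition _ n := isMeasurableFun.Build _ _ _ _
  (@cons_rV n) (@measurable_cons_rV n).

Definition behead_rV n (v : borel_rV R n.+1) : borel_rV R n :=
  rsubmx (v : 'rV[R]_(1 + n)).

Lemma measurable_behead_rV n : measurable_fun setT (@behead_rV n).
Proof.
apply/measurable_fun_rVP => j.
under eq_fun do rewrite /behead_rV mxE.
exact: measurable_coord.
Qed.

Section step.
Context n (mu : {sigma_finite_measure set (borel_rV R n) -> \bar R}).

Definition cons_measure : set (borel_rV R n.+1) -> \bar R :=
  image_measure (@lebesgue_measure R \x mu)%E (@cons_rV n).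

HB.instance Definition _ := Measure.on cons_measure.

Lemma cons_measure_sigma_finite : sigma_finite setT cons_measure.
Proof.
have [F TF Foo] : sigma_finite setT (@lebesgue_measure R \x mu)%E.
  have /sigma_finiteP[F [TF ndF Foo]] := sigma_finiteT (@lebesgue_measure R).
  have /sigma_finiteP[G [TG ndG Goo]] := sigma_finiteT mu.
  exists (fun k => F k `*` G k).
    rewrite -setXTT TF TG predeqE => -[x y]; split.
      move=> [/= [k _ Fkx] [l _ Gly]]; exists (maxn k l) => //; split.
      - by move: x Fkx; exact/subsetPset/ndF/leq_maxl.
      - by move: y Gly; exact/subsetPset/ndG/leq_maxr.
    by move=> [k _ []/= ? ?]; split; exists k.
  move=> k; have [? ?] := Foo k; have [? ?] := Goo k.
  split; first exact: measurableX.
  by rewrite product_measure1E// lte_mul_pinfty// ge0_fin_numE.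
pose g (v : borel_rV R n.+1) : measurableTypeR R * borel_rV R n :=
  ((v : 'rV[R]_n.+1) 0 0, behead_rV v).
have mg : measurable_fun setT g.
  apply: measurable_fun_pair; first exact: measurable_coord.
  exact: measurable_behead_rV.
exists (fun k => g @^-1` F k).
  by rewrite -preimage_bigcup -TF preimage_setT.
move=> k; have [mF Fk] := Foo k; split.
  by rewrite -[X in measurable X]setTI; exact: mg.
rewrite /cons_measure /image_measure /pushforward -comp_preimage (_ : g \o _ = id)//.
apply/funext => -[x y]; rewrite /g /comp cons_rV0/=; congr pair.
by apply/rowP => j; rewrite /behead_rV /cons_rV row_mxKr.
Qed.

HB.instance Definition _ := Measure_isSigmaFinite.Build _ _ _
  cons_measure cons_measure_sigma_finite.

End step.

Fixpoint lebesgue_measure_rV n :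
    {sigma_finite_measure set (borel_rV R n) -> \bar R} :=
  match n with
  | 0 => @dirac _ (borel_rV R 0) 0 R
  | n'.+1 => cons_measure (lebesgue_measure_rV n')
  end.

Lemma measurable_box n (a b : R) :
  measurable [set v : borel_rV R n | forall j, (v : 'rV[R]_n) 0 j \in `[a, b]].
Proof.
rewrite (_ : [set _ | _] = \bigcap_(j in [set: 'I_n])
   ((fun v : borel_rV R n => (v : 'rV[R]_n) 0 j : measurableTypeR R)
    @^-1` [set` `[a, b]])); last first.
  by apply/seteqP; split => [x /= h j _|x h j]; [exact: h|exact: h].
apply: fin_bigcap_measurable => // j _.
by rewrite -[X in measurable X]setTI; exact: measurable_coord.
Qed.

Lemma lebesgue_measure_rV_box n (a b : R) : a <= b ->
  lebesgue_measure_rV n [set v | forall j, (v : 'rV[R]_n) 0 j \in `[a, b]] =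
  ((b - a) ^+ n)%:E.
Proof.
move=> ab; elim: n => [|n IHn].
  by rewrite /= diracE mem_set//= => -[].
rewrite [LHS]/= /cons_measure /image_measure /pushforward.
rewrite (_ : _ @^-1` _ = [set` `[a, b]] `*`
    [set v : borel_rV R n | forall j, (v : 'rV[R]_n) 0 j \in `[a, b]]).
  rewrite [LHS](@product_measure1E _ _ (measurableTypeR R) (borel_rV R n))//=; last exact: measurable_box.
  rewrite -/(lebesgue_measure_rV n) IHn exprS EFinM; congr (_ * _)%E.
  rewrite lebesgue_measure_itv/= lte_fin.
  by case: ltgtP ab => // [->]; rewrite subrr.
apply/seteqP; split=> [[x v] /= h|[x v] /= [h1 h2] j].
  split; first by have := h 0; rewrite cons_rV0.
  by move=> j; have := h (lift 0 j); rewrite cons_rVS.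
by have [j' ->|->] := unliftP 0 j; rewrite ?cons_rV0 ?cons_rVS//; exact: h2.
Qed.

End lebesgue_measure_rV.
Arguments lebesgue_measure_rV : clear implicits.

Section simplex.
Context {R : realType}.

Definition simplex d : set (borel_rV R d) :=
  [set x | (forall i, 0 <= (x : 'rV[R]_d) 0 i) /\
           \sum_(i < d) (x : 'rV[R]_d) 0 i = 1].

Lemma measurable_simplex d : measurable (@simplex d).
Proof.
rewrite (_ : @simplex d = (\bigcap_(i in [set: 'I_d])
    ((fun v : borel_rV R d => (v : 'rV[R]_d) 0 i : measurableTypeR R)
        @^-1` [set` `[0, +oo[]))
  `&` ((fun v : borel_rV R d => \sum_(i < d) (v : 'rV[R]_d) 0 i
         : measurableTypeR R) @^-1` [set 1])); last first.
  apply/seteqP; split=> x /= [h1 h2]; split=> //.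
  - by move=> i _ /=; rewrite in_itv/= h1.
  - by move=> i; have := h1 i Logic.I; rewrite /= in_itv/= andbT.
apply: measurableI.
  apply: fin_bigcap_measurable => // i _.
  by rewrite -[X in measurable X]setTI; exact: measurable_coord.
rewrite -[X in measurable X]setTI.
apply: measurable_sum => // i; exact: measurable_coord.
Qed.

(* The affine parametrization of the hyperplane sum_i x_i = 1 by its first
   d - 1 coordinates. *)
Definition hyperplane_chart d (y : borel_rV R d.-1) : borel_rV R d :=
  \row_(i < d) if insub (i : nat) is Some j then (y : 'rV[R]_d.-1) 0 j
               else 1 - \sum_j (y : 'rV[R]_d.-1) 0 j.

Lemma measurable_hyperplane_chart d :
  measurable_fun setT (@hyperplane_chart d).
Proof.
apply/measurable_fun_rVP => i.
under eq_fun do rewrite mxE.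
case: insub => [j|]; first exact: measurable_coord.
apply: measurable_funB => //.
by apply: measurable_sum => j; exact: measurable_coord.
Qed.

HB.instance Definition _ d := isMeasurableFun.Build _ _ _ _
  (@hyperplane_chart d) (@measurable_hyperplane_chart d).

(* (d-1)-dimensional Lebesgue measure on the hyperplane sum_i x_i = 1, as a
   measure on R^d.  The volume factor of hyperplane_chart is
   sqrt (det (J^T J)) with J its Jacobian matrix; as J^T J is the sum of the
   identity and of the all-ones matrix of size d - 1, the factor is sqrt d. *)
Definition lebesgue_hyperplane d : {measure set (borel_rV R d) -> \bar R} :=
  mscale (NngNum (sqrtr_ge0 (d%:R : R)))
    (image_measure (lebesgue_measure_rV R d.-1) (@hyperplane_chart d)).

Definition lebesgue_simplex d : {measure set (borel_rV R d) -> \bar R} :=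
  mrestr (lebesgue_hyperplane d) (@measurable_simplex d).

(* The last argument of mnormalize, its value when the total mass is 0 or
   +oo, is irrelevant for 0 < d: see lebesgue_simplex_gt0 and
   lebesgue_simplex_lty. *)
Definition uniform_simplex d : probability (borel_rV R d) R :=
  mnormalize (lebesgue_simplex d) (@dirac _ (borel_rV R d) 0 R).

Lemma hyperplane_chart_widen n (y : 'rV[R]_n) (j : 'I_n) :
  (hyperplane_chart (y : borel_rV R n.+1.-1) : 'rV[R]_n.+1) 0
    (widen_ord (leqnSn n) j) = y 0 j.
Proof.
rewrite /hyperplane_chart mxE; case: insubP => /= [k _ kj|].
  by congr (y _ _); exact: val_inj.
by rewrite ltn_ord.
Qed.

Lemma hyperplane_chart_max n (y : 'rV[R]_n) :
  (hyperplane_chart (y : borel_rV R n.+1.-1) : 'rV[R]_n.+1) 0 ord_max =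
  1 - \sum_j y 0 j.
Proof.
by rewrite /hyperplane_chart mxE; case: insubP => /= [k|]; rewrite ?ltnn.
Qed.

Lemma lebesgue_simplexTE d : lebesgue_simplex d setT =
  ((Num.sqrt (d%:R : R))%:E *
   lebesgue_measure_rV R d.-1 (@hyperplane_chart d @^-1` @simplex d))%E.
Proof. by rewrite /lebesgue_simplex /= /mrestr setTI. Qed.

Lemma lebesgue_simplex_gt0 d : (0 < d)%N -> (0 < lebesgue_simplex d setT)%E.
Proof.
case: d => // n _; rewrite lebesgue_simplexTE mule_gt0 ?lte_fin ?sqrtr_gt0//.
have n0 : 0 <= n.+1%:R^-1 :> R by rewrite invr_ge0.
apply: (@lt_le_trans _ _ (lebesgue_measure_rV R n
  [set v | forall j, (v : 'rV[R]_n) 0 j \in `[0, n.+1%:R^-1]])).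
  by rewrite lebesgue_measure_rV_box// lte_fin subr0 exprn_gt0// invr_gt0.
apply: le_measure; rewrite ?inE.
- exact: measurable_box.
- rewrite -[X in measurable X]setTI.
  exact: (@measurable_hyperplane_chart n.+1 measurableT _
    (@measurable_simplex n.+1)).
move=> y /= yb; split; last first.
  rewrite big_ord_recr/= hyperplane_chart_max.
  under eq_bigr do rewrite hyperplane_chart_widen.
  by rewrite addrCA subrr addr0.
move=> i; have [j ->|->] := unliftP ord_max i.
  have -> : lift ord_max j = widen_ord (leqnSn n) j.
    by apply: val_inj; rewrite /= /bump leqNgt ltn_ord.
  by rewrite hyperplane_chart_widen; have := yb j; rewrite in_itv/= => /andP[].
rewrite hyperplane_chart_max subr_ge0.
apply: (@le_trans _ _ (\sum_(j < n) n.+1%:R^-1)).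
  by apply: ler_sum => j _; have := yb j; rewrite in_itv/= => /andP[].
by rewrite sumr_const card_ord -[leLHS]mulr_natl ler_pdivrMr// mul1r ler_nat.
Qed.

Lemma lebesgue_simplex_lty d : (0 < d)%N -> (lebesgue_simplex d setT < +oo)%E.
Proof.
case: d => // n _; rewrite lebesgue_simplexTE.
apply: lte_mul_pinfty; rewrite ?lee_fin ?sqrtr_ge0//.
apply: (@le_lt_trans _ _ (lebesgue_measure_rV R n
  [set v | forall j, (v : 'rV[R]_n) 0 j \in `[0, 1]])); last first.
  by rewrite lebesgue_measure_rV_box// ltry.
apply: le_measure; rewrite ?inE.
- rewrite -[X in measurable X]setTI.
  exact: (@measurable_hyperplane_chart n.+1 measurableT _
    (@measurable_simplex n.+1)).
- exact: measurable_box.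
move=> y [/= y0 y1] j.
rewrite in_itv/= -hyperplane_chart_widen y0/= -y1.
rewrite (bigD1 (widen_ord (leqnSn n) j))//= lerDl sumr_ge0// => i _; exact: y0.
Qed.

End simplex.
Arguments simplex : clear implicits.
Arguments hyperplane_chart : clear implicits.
Arguments lebesgue_hyperplane : clear implicits.
Arguments lebesgue_simplex : clear implicits.
Arguments uniform_simplex : clear implicits.

Definition mutually_independent d0 d1 (T : measurableType d0)
    (T' : measurableType d1) (R : realType) (P : probability T R)
    (I : finType) (X : I -> {RV P >-> T'}) : Prop :=
  forall (J : {set I}) (B : I -> set T'), (forall i, measurable (B i)) ->
    P (\bigcap_(i in [set` J]) (X i @^-1` B i)) =
    (\prod_(i in J) P (X i @^-1` B i))%E.
Arguments mutually_independent {d0 d1 T T' R} P {I} X.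

(* Main.v *)
From HB Require Import structures.
Require Import Defs.
From mathcomp Require Import all_boot all_order all_algebra.
From mathcomp Require Import all_classical all_reals all_analysis.
From mathcomp Require Import measurable_realfun.

(* Let M_k be the random matrix whose row i is Gamma_i for i < k and the i-th
   vector of the canonical basis for i >= k; thus det M_0 = 1.  Expanding along
   row k, det M_k.+1 is the scalar product of Gamma_k with the vector of
   cofactors of that row.  This vector depends only on the Gamma_i with i < k,
   hence is independent of Gamma_k, and it is nonzero wherever det M_k is.  As
   Psi gives measure 0 to every linear hyperplane, Tonelli's theorem shows that
   det M_k.+1 <> 0 almost surely as soon as det M_k <> 0 almost surely. *)

Set Implicit Arguments.
Unset Strict Implicit.
Unset Printing Implicit Defensive.

Import Order.TTheory GRing.Theory Num.Theory.
Import numFieldNormedType.Exports.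

Local Open Scope classical_set_scope.
Local Open Scope ring_scope.

(** * Null sets: products, affine subspaces, the simplex *)

Lemma product_measure1_null d1 d2 (T1 : measurableType d1)
    (T2 : measurableType d2) (R : realType)
    (m1 : {measure set T1 -> \bar R})
    (m2 : {sigma_finite_measure set T2 -> \bar R})
    (N : set T1) (A : set (T1 * T2)) :
  measurable A -> measurable N -> m1 N = 0%E ->
  (forall x, ~ N x -> m2 (xsection A x) = 0%E) -> (m1 \x m2)%E A = 0%E.
Proof.
move=> mA mN N0 A0; rewrite /product_measure1.
rewrite (ge0_negligible_integral mN)//.
- by apply: integral0_eq => x [_ /A0].
- exact: measurable_fun_xsection.
Qed.

(** Induction on [n], slicing by the first coordinate [x]: each slice solves an equation of the same
    form, with constant term [a 0 0 * x + b]. Allowing [a = 0] with [b != 0] (no solutions) lets the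
    induction hypothesis apply to slices whose linear part vanishes. *)
Lemma lebesgue_measure_rV_affine (R : realType) n (a : 'rV[R]_n) (b : R) :
  (a != 0) || (b != 0) ->
  lebesgue_measure_rV R n
    [set y | \sum_j a 0 j * (y : 'rV[R]_n) 0 j + b = 0] = 0%E.
Proof.
have mS m (a' : 'rV[R]_m) (c : R) : measurable
    [set y : borel_rV R m | \sum_j a' 0 j * (y : 'rV[R]_m) 0 j + c = 0].
  have mf : measurable_fun setT (fun y : borel_rV R m =>
      \sum_j a' 0 j * (y : 'rV[R]_m) 0 j + c : measurableTypeR R).
    apply: measurable_funD => //; apply: measurable_sum => j.
    by apply: measurable_funM => //; exact: measurable_coord.
  by rewrite -[X in measurable X]setTI; exact: (mf measurableT _ (measurable_set1 0)).
elim: n a b => [a b|n IHn a b ab0].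
  rewrite (_ : a = 0) ?eqxx//=; last by apply/rowP; case.
  move=> b0; rewrite (_ : [set _ | _] = set0) ?measure0//.
  by rewrite -subset0 => y /=; rewrite big_ord0 add0r; exact/eqP.
rewrite [LHS]/= /cons_measure /image_measure /pushforward.
pose a' : 'rV[R]_n := \row_j a 0 (lift 0 j).
(* [N] collects the [x] whose slice equation degenerates to [0 = 0]; it is empty or the single point
   [- b / a 0 0]. *)
pose N : set (measurableTypeR R) := [set x | a' = 0 /\ a 0 0 * x + b = 0].
have consE x y : \sum_j a 0 j * (cons_rV (x, y) : 'rV[R]_n.+1) 0 j + b =
    \sum_j a' 0 j * (y : 'rV[R]_n) 0 j + (a 0 0 * x + b).
  rewrite big_ord_recl cons_rV0 addrAC addrC; congr (_ + _).
  by apply: eq_bigr => j _; rewrite cons_rVS mxE.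
have [mN N0] : measurable N /\ lebesgue_measure N = 0%E.
  have [a'0|a'0] := eqVneq a' 0; last first.
    by rewrite (_ : N = set0) ?measure0// -subset0 => x [] /eqP; rewrite (negbTE a'0).
  have [a00|a00] := eqVneq (a 0 0) 0.
    rewrite (_ : N = set0) ?measure0// -subset0 => x [_]; rewrite a00 mul0r add0r => b0.
    move: ab0; rewrite b0 eqxx orbF => /eqP; apply; apply/rowP => j.
    rewrite mxE; have [j' ->|->//] := unliftP 0 j.
    by move/rowP : a'0 => /(_ j'); rewrite !mxE.
  rewrite (_ : N = [set - b / a 0 0]); last first.
    apply/seteqP; split => x /=.
      by move=> [_ /eqP]; rewrite addr_eq0 => /eqP <-; rewrite mulrAC mulfV ?mul1r.
    by move=> ->; split => //; rewrite mulrC divfK// addNr.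
  by split; [exact: measurable_set1|exact: lebesgue_measure_set1].
apply: (@product_measure1_null _ _ (measurableTypeR R) (borel_rV R n) _ _ _ N _ _ mN N0) => [|x Nx].
  rewrite -[X in measurable X]setTI; exact: measurable_cons_rV.
rewrite (_ : xsection _ _ =
    [set y | \sum_j a' 0 j * (y : 'rV[R]_n) 0 j + (a 0 0 * x + b) = 0]).
  apply: IHn; have [a'0/=|//] := eqVneq a' 0.
  by apply/eqP => xb0; apply: Nx.
apply/seteqP; split => y; rewrite /xsection/= inE/=; first by rewrite consE.
by rewrite consE.
Qed.

(** Substituting one minus the sum of the others for the last coordinate turns the equation into an
    affine one in the chart, with coefficients [c j - c ord_max] and constant [c ord_max]. These all
    vanish only if [c = 0]. *)
Lemma lebesgue_hyperplane_linear (R : realType) d (c : 'rV[R]_d) : c != 0 ->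
  lebesgue_hyperplane R d
    [set v | \sum_j (v : 'rV[R]_d) 0 j * c 0 j = 0] = 0%E.
Proof.
case: d c => [c /eqP[]|n c c0]; first by apply/rowP; case.
rewrite /lebesgue_hyperplane/= /mscale/= /image_measure /pushforward.
pose a : 'rV[R]_n := \row_j (c 0 (widen_ord (leqnSn n) j) - c 0 ord_max).
rewrite (_ : _ @^-1` _ =
    [set y | \sum_j a 0 j * (y : 'rV[R]_n) 0 j + c 0 ord_max = 0]).
  rewrite lebesgue_measure_rV_affine ?mule0//.
  have [a0/=|//] := eqVneq a 0; apply: contraNN c0 => /eqP cm0.
  apply/eqP/rowP => i; rewrite mxE.
  have [j ->|->//] := unliftP ord_max i.
  have -> : lift ord_max j = widen_ord (leqnSn n) j.
    by apply: val_inj; rewrite /= /bump leqNgt ltn_ord.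
  by move/rowP : a0 => /(_ j); rewrite !mxE cm0 subr0.
rewrite /preimage; apply: eq_set => y /=; congr (_ = _).
rewrite big_ord_recr/= hyperplane_chart_max mulrBl mul1r mulr_suml addrCA addrC.
rewrite -sumrB; congr (_ + _); apply: eq_bigr => j _.
by rewrite hyperplane_chart_widen !mxE mulrBl ![_ * y _ _]mulrC.
Qed.

Lemma null_dominated_by_uniform_simplex (R : realType) d
    (Psi : probability (borel_rV R d) R) (A : set (borel_rV R d)) :
  (0 < d)%N -> Psi `<< uniform_simplex R d -> measurable A ->
  lebesgue_hyperplane R d A = 0%E -> Psi A = 0%E.
Proof.
move=> d0 /null_content_dominatesP ac mA A0; apply: ac => //.
rewrite /uniform_simplex/= /mnormalize.
(* The total mass is positive and finite, so [mnormalize] does not take its default value. *)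
rewrite gt_eqF ?lebesgue_simplex_gt0//= lt_eqF ?lebesgue_simplex_lty//=.
rewrite /mscale/=.
suff A0' : lebesgue_hyperplane R d (A `&` simplex R d) = 0%E.
  by rewrite /lebesgue_simplex/= /mrestr [X in (X * _)%E]A0' mul0e.
apply/eqP; rewrite -measure_le0 -[leRHS]A0.
apply: le_measure; rewrite ?inE//.
by apply: measurableI => //; exact: measurable_simplex.
Qed.

(** * Independence and generated sigma-algebras *)

Section independence.
Context (R : realType) d0 d1 (T : measurableType d0) (T' : measurableType d1).
Variable P : probability T R.

(** In [A], both sides are finite measures: [P] restricted to [E], and [P] scaled by [P E]. Agreeing
    on the pi-system [G], which contains [setT], they agree on the sigma-algebra it generates. *)
Lemma independent_g_sigma (G : set (set T)) (E : set T) :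
  G `<=` measurable -> setI_closed G -> G setT -> measurable E ->
  (forall A, G A -> P (A `&` E) = P A * P E)%E ->
  forall A, <<s G >> A -> P (A `&` E) = (P A * P E)%E.
Proof.
move=> mG GI GT mE PG A sA.
have PE : (fine (P E))%:E = P E by rewrite fineK// fin_num_measure.
have PE0 : 0 <= fine (P E) by rewrite fine_ge0.
rewrite -[LHS]/(mrestr P mE A).
have -> : mrestr P mE A = mscale (NngNum PE0) P A.
  apply: (@g_sigma_algebra_measure_unique _ R T G mG (fun=> setT)) => //.
  - by rewrite bigcup_const//; exists 0%N.
  - by move=> B GB; rewrite -[RHS]/((fine (P E))%:E * P B)%E PE muleC; exact: PG.
  - by move=> _; rewrite (le_lt_trans (probability_le1 _ _)) ?ltry//; exact: measurableI.
by rewrite -[LHS]/((fine (P E))%:E * P A)%E PE muleC.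
Qed.

Context (I : finType) (X : I -> {RV P >-> T'}).

(** A pi-system generating the sigma-algebra of the [X j] with [j] in [J]. *)
Definition cylinders (J : {set I}) : set (set T) :=
  [set A | exists2 B : I -> set T', (forall i, measurable (B i)) &
    A = \bigcap_(i in [set` J]) (X i @^-1` B i)].

Lemma measurable_cylinders J : cylinders J `<=` measurable.
Proof.
move=> _ [B mB ->]; apply: fin_bigcap_measurable => // i _.
exact: measurable_funPTI.
Qed.

Lemma setI_closed_cylinders J : setI_closed (cylinders J).
Proof.
move=> _ _ [B mB ->] [C mC ->]; exists (fun i => B i `&` C i).
  by move=> i; exact: measurableI.
by rewrite -bigcapI; apply: eq_bigcapr => i _; rewrite preimage_setI.
Qed.

Lemma setT_cylinders J : cylinders J setT.
Proof. by exists (fun=> setT) => //; rewrite bigcapT. Qed.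

Lemma measurable_cylinder_coord (J : {set I}) j : j \in J ->
  measurable_fun setT (X j : g_sigma_algebraType (cylinders J) -> T').
Proof.
move=> jJ _ B mB; rewrite setTI; apply: sub_sigma_algebra.
exists (fun i => if i == j then B else setT); first by move=> i; case: ifP.
apply/seteqP; split => x /=.
  by move=> Bx i _ /=; case: eqP => // ->.
by move=> /(_ j jJ) /=; rewrite eqxx.
Qed.

Hypothesis indepX : mutually_independent P X.

Lemma independent_cylinders (J : {set I}) i (A : set T) (B : set T') : i \notin J ->
  <<s cylinders J >> A -> measurable B ->
  P (A `&` X i @^-1` B) = (P A * P (X i @^-1` B))%E.
Proof.
move=> iJ sA mB; apply: independent_g_sigma sA.
- exact: measurable_cylinders.
- exact: setI_closed_cylinders.
- exact: setT_cylinders.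
- exact: measurable_funPTI.
move=> _ [C mC ->].
(* [D] merges [B] at [i] with [C] on [J], so that independence over [i |: J] treats the whole
   intersection at once. *)
pose D j := if j == i then B else C j.
have mD j : measurable (D j) by rewrite /D; case: ifP.
have DC j : j \in J -> D j = C j.
  by move=> jJ; rewrite /D; case: eqP => // ji; rewrite -ji jJ in iJ.
rewrite (indepX J mC).
have := indepX (i |: J) mD.
rewrite big_setU1//= {2}/D eqxx muleC.
under eq_bigr do rewrite DC//.
move=> <-; congr (P _); apply/seteqP; split => x /=.
  move=> [h Bx] j /=; rewrite in_setU1 => /orP[/eqP ->|jJ]; first by rewrite /D eqxx.
  by rewrite DC//; exact: h.
move=> h; split; last by have /= := h i; rewrite setU11 /D eqxx; exact.
by move=> j /= jJ; have /= := h j; rewrite setU1r// DC//; exact.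
Qed.

(** A null set may be checked with the outcome frozen in the first component, because [X i] is
    independent of the sigma-algebra of the other [X j] considered. *)
Lemma mutually_independent_null (J : {set I}) i
    (N : set (g_sigma_algebraType (cylinders J) * T')) :
  i \notin J -> measurable N ->
  (forall w, distribution P (X i) (xsection N w) = 0%E) ->
  P.-negligible [set w | N (w, X i w)].
Proof.
move=> iJ mN N0.
(* T with the sub-sigma-algebra generated by the X j for j in J, so that Tonelli
   applies to the joint law of the identity T -> S and of X i. *)
pose S := g_sigma_algebraType (cylinders J).
have mid : measurable_fun setT (id : T -> S).
  move=> _ A sA; rewrite setTI preimage_id.
  by apply: (smallest_sub _ (@measurable_cylinders J) sA); exact: sigma_algebra_measurable.
have mpair : measurable_fun setT (fun w : T => (w : S, X i w)).
  by apply: measurable_fun_pair.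
pose idX : {RV P >-> S} := HB.pack id (isMeasurableFun.Build _ _ _ _ _ mid).
pose pairX : {RV P >-> (S * T')%type} := HB.pack (fun w : T => (w : S, X i w))
  (isMeasurableFun.Build _ _ _ _ _ mpair).
exists (pairX @^-1` N); split => //; first exact: measurable_funPTI.
rewrite -[LHS]/(distribution P pairX N).
(* By independence the joint law agrees with the product of the marginals on rectangles, hence
   everywhere. *)
rewrite -(@product_measure_unique _ _ S T' R (distribution P idX) (distribution P (X i)))//.
  apply: (@product_measure1_null _ _ S T' _ _ _ set0) => // x _; exact: N0.
move=> A B sA mB; rewrite /distribution /pushforward/= -(independent_cylinders iJ)//.
Qed.

End independence.

(** * Determinants and the induction on random rows *)

Lemma measurable_det (R : realType) disp (T : measurableType disp) n
    (M : T -> 'M[R]_n) :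
  (forall i j, measurable_fun setT (fun w => M w i j : measurableTypeR R)) ->
  measurable_fun setT (fun w => \det (M w) : measurableTypeR R).
Proof.
move=> mM; rewrite /determinant.
apply: measurable_sum => s; apply: measurable_funM => //.
by apply: measurable_prod => i _; exact: mM.
Qed.

Lemma measurable_cofactor (R : realType) disp (T : measurableType disp) n
    (M : T -> 'M[R]_n) i j :
  (forall i j, measurable_fun setT (fun w => M w i j : measurableTypeR R)) ->
  measurable_fun setT (fun w => cofactor (M w) i j : measurableTypeR R).
Proof.
move=> mM; rewrite /cofactor; apply: measurable_funM => //.
apply: measurable_det => i' j'.
by under eq_fun do rewrite !mxE; exact: mM.
Qed.

(** The coefficients of a vanishing linear combination form a row vector killed by an invertible
    matrix. *)
Lemma free_det_neq0 (F : fieldType) n (v : 'I_n -> 'rV[F]_n) :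
  \det (\matrix_(i, j) v i 0 j) != 0 -> free [seq v i | i : 'I_n].
Proof.
move=> dv; have vM i : row i (\matrix_(i, j) v i 0 j) = v i.
  by apply/rowP => j; rewrite !mxE.
rewrite -[image_mem _ _]/(tval [tuple of map v (ord_tuple n)]).
apply/freeP => k k0.
have kM : (\row_i k i) *m (\matrix_(i, j) v i 0 j) = 0.
  rewrite mulmx_sum_row -[RHS]k0; apply: eq_bigr => i _.
  by rewrite vM mxE -tnth_nth tnth_map tnth_ord_tuple.
move=> i; rewrite -unitfE -unitmxE in dv.
have /rowP/(_ i) : \row_i k i = 0.
  by rewrite -[LHS](mulmxK dv) kM mul0mx.
by rewrite !mxE.
Qed.

Theorem proposition4p1 (R : realType) (d : nat) (d_gt0 : (0 < d)%N)
  (Psi : probability (borel_rV R d) R)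
  (Psi_simplex : Psi (simplex R d) = 1%E)
  (Psi_ac : Psi `<< uniform_simplex R d)
  (disp : measure_display) (Omega : measurableType disp)
  (P : probability Omega R)
  (Gamma : 'I_d -> {RV P >-> borel_rV R d})
  (Gamma_indep : mutually_independent P Gamma)
  (Gamma_distr : forall i (A : set (borel_rV R d)), measurable A ->
     distribution P (Gamma i) A = Psi A) :
  {ae P, forall w, free [seq (Gamma i w : 'rV[R]_d) | i : 'I_d]}.
Proof.
pose M k w : 'M[R]_d :=
  \matrix_(i, j) if (i < k)%N then (Gamma i w : 'rV[R]_d) 0 j else (i == j)%:R.
suff MN k : (k <= d)%N -> P.-negligible [set w | \det (M k w) = 0].
  apply: negligibleS (MN d (leqnn d)) => w; apply: contra_notP => /eqP Mw.
  apply: free_det_neq0; rewrite (_ : matrix_of_fun _ _ = M d w)//.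
  by apply/matrixP => i j; rewrite !mxE ltn_ord.
elim: k => [_|k IHk kd].
  rewrite (_ : [set _ | _] = set0); first exact: negligible_set0.
  rewrite -subset0 => w /=; rewrite (_ : M _ _ = 1%:M).
    by rewrite det1 => /eqP; rewrite oner_eq0.
  by apply/matrixP => i j; rewrite !mxE.
pose i0 := Ordinal kd; pose J := [set i : 'I_d | (i < k)%N]%SET.
pose S := g_sigma_algebraType (cylinders Gamma J).
have mM i j : measurable_fun setT (fun w : S => M k w i j : measurableTypeR R).
  rewrite /M; under eq_fun do rewrite mxE.
  case: (ltnP i k) => ik; last exact: measurable_cst.
  apply: (measurableT_comp (measurable_coord j)).
  by apply: measurable_cylinder_coord; rewrite inE.
pose dot (p : S * borel_rV R d) : measurableTypeR R :=
  \sum_j (p.2 : 'rV[R]_d) 0 j * cofactor (M k p.1) i0 j.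
(* The bad event of this step: [M k] is invertible, yet the new row is orthogonal to the cofactors
   along row [i0]. *)
pose N : set (S * borel_rV R d) := [set p | \det (M k p.1) != 0 /\ dot p = 0].
have mN : measurable N.
  have mdot : measurable_fun setT dot.
    apply: measurable_sum => j; apply: measurable_funM.
      exact: (measurableT_comp (measurable_coord j)).
    by apply: (measurableT_comp (measurable_cofactor i0 j mM)).
  have -> : N = ((fun p => \det (M k p.1)) @^-1` [set~ 0]) `&` (dot @^-1` [set 0]).
    by apply/seteqP; split => p /= [/eqP ? ?].
  apply: measurableI; last first.
    by rewrite -[X in measurable X]setTI; exact: (mdot measurableT _ (measurable_set1 0)).
  rewrite -[X in measurable X]setTI.
  have mdet : measurable_fun setT
      (fun p : S * borel_rV R d => \det (M k p.1) : measurableTypeR R).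
    exact: (measurableT_comp (measurable_det mM)).
  by apply: mdet => //; apply: measurableC; exact: measurable_set1.
apply: negligibleS (negligibleU (IHk (ltnW kd))
  (mutually_independent_null Gamma_indep (i := i0) _ mN _)).
(* [M k] and [M k.+1] differ only in row [i0], so they share the cofactors along that row. *)
- move=> w /= Mw; have [|Mkw] := eqVneq (\det (M k w)) 0; [by left|right].
  split => //; rewrite -Mw (expand_det_row _ i0); apply: eq_bigr => j _.
  rewrite mxE ltnSn; congr (_ * (_ * \det _)).
  apply/matrixP => i l; rewrite !mxE ltnS [in RHS]leq_eqVlt.
  rewrite (_ : nat_of_ord (lift i0 i) == k = false)//.
  by apply/negbTE; rewrite -[k]/(val i0) eq_sym (inj_eq val_inj) neq_lift.
- by rewrite inE ltnn.
move=> w.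
have [Mw|Mw] := eqVneq (\det (M k w)) 0.
  rewrite (_ : xsection _ _ = set0) ?measure0// -subset0 => v.
  by rewrite /xsection/= inE /N/= Mw eqxx => -[].
pose c : 'rV[R]_d := \row_j cofactor (M k w) i0 j.
(* Expanding [\det (M k w)] along row [i0] would give 0 if all these cofactors vanished. *)
have c0 : c != 0.
  apply: contraNneq Mw => /rowP c0.
  rewrite (expand_det_row _ i0) big1// => j _.
  by have := c0 j; rewrite !mxE => ->; rewrite mulr0.
have mxN : measurable (xsection N w) by exact: measurable_xsection.
rewrite Gamma_distr//.
apply: null_dominated_by_uniform_simplex => //.
rewrite -(lebesgue_hyperplane_linear c0); congr (lebesgue_hyperplane _ _ _).
apply: eq_set => v; rewrite /= inE /N/=; apply/propext; split => [[_ vc]|vc].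
  by rewrite -[RHS]vc; apply: eq_bigr => j _; rewrite mxE.
by split => //; rewrite -[RHS]vc; apply: eq_bigr => j _; rewrite mxE.
Qed.
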